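(* Let $\{d_{n,k}\}_{n,k\ge0}$ be a proper Riordan array, and let $A(t)$ be the generating function of its $A$-sequence. Then for any integers $p\ge2$ and $r\ge0$, $$\tilde d_{n,k}=d_{pn+r,\,(p-1)n+r+k}\qquad (n,k\ge0)$$ defines a Riordan array $\{\tilde d_{n,k}\}_{n,k\ge0}$. Moreover, the generating function of the $A$-sequence of $\{\tilde d_{n,k}\}_{n,k\ge0}$ is $\big(A(t)\big)^p$.
   Context: Formal power series are taken with, say, complex coefficients, and $[t^n]g(t)$ denotes the coefficient of $t^n$ in $g(t)$. A Riordan array is an infinite lower triangular array $\{d_{n,k}\}_{n,k\ge0}$ defined by a pair of formal power series $(d(t),h(t))$ through $d_{n,k}=[t^n]\,d(t)\big(th(t)\big)^k$ for all $n,k\ge0$. It is called proper if $h(0)\neq0$. For a proper Riordan array $(d(t),h(t))$ there is a unique sequence $(a_k)_{k\ge0}$, called its $A$-sequence, with generating function $A(t)=\sum_{k\ge0}a_kt^k$, such that $h(t)=A\big(th(t)\big)$; one then has $d_{n+1,k+1}=a_0d_{n,k}+a_1d_{n,k+1}+a_2d_{n,k+2}+\cdots$ for all $n,k\ge0$. *)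

(* Defs.v *)
From HB Require Import structures.
From mathcomp Require Import all_boot all_order all_algebra.

Set Implicit Arguments.
Unset Strict Implicit.
Unset Printing Implicit Defensive.

Import GRing.Theory.
Local Open Scope ring_scope.

(* The series f(t) is the function n |-> [t^n] f(t). A dedicated product is
   used, since the ring structures on function types are pointwise. *)
Definition fps (F : fieldType) := nat -> F.

Section PowerSeries.
Variable F : fieldType.
Implicit Types f g : fps F.

Definition fps_one : fps F := fun n => (n == 0%N)%:R.

Definition fps_t : fps F := fun n => (n == 1%N)%:R.

Definition fps_mul f g : fps F := fun n => \sum_(i < n.+1) f i * g (n - i)%N.

Definition fps_exp f (m : nat) : fps F := iter m (fps_mul f) fps_one.

(* f(g(t)), meaningful only when g(0) = 0: then [t^n] g(t)^k = 0 for k > n,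
   so the sum over all k is the finite sum below. *)
Definition fps_comp f g : fps F :=
  fun n => \sum_(k < n.+1) f k * fps_exp g k n.

End PowerSeries.

Definition riordan (F : fieldType) (d h : fps F) (n k : nat) : F :=
  fps_mul d (fps_exp (fps_mul (fps_t F) h) k) n.

(* The condition under which the array (d, h) is proper is h(0) != 0, and its
   A-sequence is determined by h alone. It is attached to the pair because the
   entries of the array determine h only when d != 0. *)
Definition is_proper (F : fieldType) (h : fps F) : Prop := h 0%N != 0.

Definition is_A_sequence (F : fieldType) (h A : fps F) : Prop :=
  h =1 fps_comp A (fps_mul (fps_t F) h).

(* Main.v *)
(* Since h = A(th), multiplying a series by (th)^p = t^p A(th)^p gives the
   p-fold iterate of the A-sequence recurrence,
   d_(n+p,k+p) = sum_j [t^j]A(t)^p d_(n,k+j). Hence the array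
   d_(pn+r,(p-1)n+r+k) satisfies the one-step recurrence with the sequence A^p,
   and so does the Riordan array whose first series is its column 0 and whose
   second series solves ht = A(t ht)^p. Column 0, lower triangularity and the
   recurrence determine an array, so the two coincide. *)
Require Import Defs.
From HB Require Import structures.
From mathcomp Require Import all_boot all_order all_algebra.
From mathcomp Require Import zify.

Set Implicit Arguments.
Unset Strict Implicit.
Unset Printing Implicit Defensive.

Import GRing.Theory.
Local Open Scope ring_scope.

Section Approximation.
Variable F : fieldType.
Implicit Types (f g d h A : fps F) (a P Q H : {poly F}).

(* Identities between series are obtained from the ring {poly F} by working
   modulo t^N. *)
Definition approx (N : nat) f P : Prop := forall i, (i < N)%N -> P`_i = f i.

Definition fps_trunc (N : nat) f : {poly F} := \poly_(i < N) f i.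

Lemma approx_trunc N f : approx N f (fps_trunc N f).
Proof. by move=> i ltiN; rewrite coef_poly ltiN. Qed.

Lemma approx_one N : approx N (@fps_one F) 1.
Proof. by move=> i _; rewrite coef1. Qed.

Lemma approx_t N : approx N (@fps_t F) 'X.
Proof. by move=> i _; rewrite coefX. Qed.

Lemma approx_mul N f g P Q :
  approx N f P -> approx N g Q -> approx N (fps_mul f g) (P * Q).
Proof.
move=> fP gQ i ltiN; rewrite coefM; apply: eq_bigr => j _.
by rewrite fP ?gQ //; have := ltn_ord j; lia.
Qed.

Lemma approx_exp N f P m : approx N f P -> approx N (fps_exp f m) (P ^+ m).
Proof.
move=> fP; elim: m => [|m IHm]; first exact: approx_one.
by rewrite exprS; apply: approx_mul.
Qed.

Lemma coef_XMnM_lt H Q i n : (n < i)%N -> (('X * H) ^+ i * Q)`_n = 0.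
Proof. by move=> ltni; rewrite exprMn -mulrA coefXnM ltni. Qed.

(** Since ['X * H] has no constant term, its powers beyond [n] do not reach t^n, so both sums equal
    the one over [size a + n.+1] indices. The factor [Q] lets the lemma serve plain composition and
    the recurrence alike. *)
Lemma coef_comp_XM a H Q n :
  ((a \Po ('X * H)) * Q)`_n = \sum_(i < n.+1) a`_i * (('X * H) ^+ i * Q)`_n.
Proof.
rewrite comp_polyE mulr_suml coef_sum.
under eq_bigr => i _ do rewrite -scalerAl coefZ.
pose u i := a`_i * (('X * H) ^+ i * Q)`_n.
transitivity (\sum_(i < size a + n.+1) u i).
  rewrite big_split_ord /= [X in _ = _ + X]big1 ?addr0 // => i _.
  by rewrite /u nth_default ?mul0r // leq_addr.
rewrite addnC big_split_ord /= [X in _ + X]big1 ?addr0 // => i _.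
by rewrite /u coef_XMnM_lt ?mulr0 // ltn_addr.
Qed.

(** The factor t gains one order of precision; the fixed-point construction in [A_sequence_exists]
    rests on this gain. *)
Lemma approx_tmul N h H :
  approx N h H -> approx N.+1 (fps_mul (@fps_t F) h) ('X * H).
Proof.
move=> hH i ltiN.
have := approx_mul (@approx_t i.+1) (@approx_trunc i.+1 h).
move=> /(_ i (ltnSn i)) <-; rewrite !coefXM; case: i ltiN => //= i ltiN.
by rewrite hH // coef_poly ltnW.
Qed.

Lemma approx_comp_tmul N A h a H : approx N.+1 A a -> approx N h H ->
  approx N.+1 (fps_comp A (fps_mul (@fps_t F) h)) (a \Po ('X * H)).
Proof.
move=> Aa hH n ltnN; rewrite -[_ \Po _]mulr1 coef_comp_XM.
apply: eq_bigr => i _; have := ltn_ord i => ltin.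
rewrite Aa; last by lia.
by rewrite mulr1 (approx_exp i (approx_tmul hH)).
Qed.

Lemma approx_riordan N d h P H n k : approx N d P -> approx N h H ->
  (n < N)%N -> riordan d h n k = (P * ('X * H) ^+ k)`_n.
Proof.
move=> dP hH ltnN; apply/esym.
have hX := approx_mul (@approx_t N) hH.
exact: (approx_mul dP (approx_exp k hX)).
Qed.

Lemma riordan_gt d h n k : (n < k)%N -> riordan d h n k = 0.
Proof.
move=> ltnk.
rewrite (approx_riordan _ (@approx_trunc n.+1 d) (@approx_trunc n.+1 h)) //.
by rewrite mulrC coef_XMnM_lt.
Qed.

Lemma riordan_col0 d h n : riordan d h n 0 = d n.
Proof.
rewrite (approx_riordan _ (@approx_trunc n.+1 d) (@approx_trunc n.+1 h)) //.
by rewrite expr0 mulr1 coef_poly ltnSn.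
Qed.

Lemma riordan_iter_recurrence d h A p n k : is_A_sequence h A ->
  riordan d h (n + p)%N (k + p)%N =
  \sum_(j < n.+1) fps_exp A p j * riordan d h n (k + j)%N.
Proof.
move=> hA; set N := (n + p).+1.
have dP := @approx_trunc N d; set P := fps_trunc N d in dP.
have hH := @approx_trunc N h; set H := fps_trunc N h in hH.
have Aa := @approx_trunc N A; set a := fps_trunc N A in Aa.
have hS : approx N h (a \Po ('X * H)).
  move=> i ltiN; rewrite hA; apply: (@approx_comp_tmul (n + p)) => // j ltj.
  by apply: hH; lia.
(* Both H and the composite approximate h; the composite is used for p of the
   factors only, so that the powers of tH remain visible. *)
have ->: riordan d h (n + p)%N (k + p)%N =
         ('X^p * ((a ^+ p \Po ('X * H)) * (P * ('X * H) ^+ k)))`_(n + p)%N.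
  pose Q := P * ('X * H) ^+ k * 'X^p.
  have QQ : approx N (fun i => Q`_i) Q by [].
  rewrite (approx_riordan _ dP hH) // exprD mulrA [_ ^+ p]exprMn mulrA.
  rewrite (approx_mul QQ (approx_exp p hH)) //.
  rewrite -(approx_mul QQ (approx_exp p hS)) // rmorphXn /=.
  by rewrite [Q * _]mulrC /Q [_ * 'X^p]mulrC [_ * ('X^p * _)]mulrCA.
rewrite coefXnM ltnNge leq_addl /= addnK coef_comp_XM.
apply: eq_bigr => j _; have := ltn_ord j => ltjn.
rewrite (approx_exp p Aa) ?(approx_riordan _ dP hH); try by rewrite /N; lia.
by rewrite mulrCA -exprD addnC.
Qed.

Lemma eq_fps_comp_tmul N A f g : (forall i, (i < N)%N -> f i = g i) ->
  forall i, (i < N.+1)%N ->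
  fps_comp A (fps_mul (@fps_t F) f) i = fps_comp A (fps_mul (@fps_t F) g) i.
Proof.
move=> eqfg i ltiN; have Aa := @approx_trunc N.+1 A.
have fP := @approx_trunc N f.
have gP : approx N g (fps_trunc N f) by move=> j ltjN; rewrite fP // eqfg.
by rewrite -(approx_comp_tmul Aa fP) // -(approx_comp_tmul Aa gP).
Qed.

(** [Phi] is a t-adic contraction: series that agree below t^m have images that agree through t^m.
    Its iterates therefore stabilise coefficientwise to a fixed point. *)
Lemma A_sequence_exists A : exists h, is_A_sequence h A.
Proof.
pose Phi f : fps F := fps_comp A (fps_mul (@fps_t F) f).
pose g m := iter m Phi A.
have stepg m : forall i, (i < m)%N -> g m.+1 i = g m i.
  elim: m => // m IHm; exact: eq_fps_comp_tmul.
have stabg m i : (i < m)%N -> g m i = g i.+1 i.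
  elim: m => // m IHm; rewrite ltnS leq_eqVlt => /predU1P[-> // | ltim].
  by rewrite stepg // IHm.
(* Coefficient [n] is constant from the iterate [n.+1] on. *)
exists (fun n => g n.+1 n) => n.
by apply: (@eq_fps_comp_tmul n) => // i; apply: stabg.
Qed.

Lemma A_sequence_0 h A : is_A_sequence h A -> h 0%N = A 0%N.
Proof. by move=> ->; rewrite /fps_comp big_ord1 /= mulr1. Qed.

Lemma fps_exp_0 f m : fps_exp f m 0%N = f 0%N ^+ m.
Proof.
by elim: m => // m IHm; rewrite exprS -IHm /= /fps_mul big_ord1 subnn.
Qed.

Lemma fps_exp1 f : fps_exp f 1 =1 f.
Proof.
move=> n; rewrite -(approx_exp 1 (@approx_trunc n.+1 f)) // expr1.
exact: approx_trunc.
Qed.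

End Approximation.

Theorem theorem2p1 (F : fieldType) (d h A : fps F)
    (h_proper : is_proper h) (hA : is_A_sequence h A)
    (p r : nat) (p_ge2 : (2 <= p)%N) :
  exists dt ht : fps F,
    [/\ is_proper ht,
        forall n k : nat,
          riordan d h (p * n + r)%N ((p - 1) * n + r + k)%N = riordan dt ht n k
      & is_A_sequence ht (fps_exp A p)].
Proof.
have [ht htB] := A_sequence_exists (fps_exp A p).
(* By [riordan_col0], column 0 of the new array forces the first series. *)
exists (fun n => riordan d h (p * n + r)%N ((p - 1) * n + r)%N), ht.
split=> //.
  rewrite /is_proper (A_sequence_0 htB) fps_exp_0 -(A_sequence_0 hA).
  exact: expf_neq0.
elim=> [|n IHn] [|k]; try by rewrite riordan_col0 addn0.
  (* In row 0, right of column 0, both entries lie above the diagonal. *)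
  by rewrite !riordan_gt //; lia.
have ->: (p * n.+1 + r = p * n + r + p)%N by lia.
have ->: ((p - 1) * n.+1 + r + k.+1 = (p - 1) * n + r + k + p)%N by nia.
rewrite (riordan_iter_recurrence _ _ _ _ hA).
(* The one-step recurrence for [ht] is the iterated one with exponent 1. *)
rewrite -(addn1 n) -(addn1 k) (riordan_iter_recurrence _ _ _ _ htB).
(* The left sum may be longer; its terms with [j > n] vanish, because [IHn] turns them into entries
   of row [n] above the diagonal. *)
rewrite (big_ord_widen (p * n + r).+1 (fun j => fps_exp (fps_exp A p) 1 j *
  riordan _ ht n (k + j)%N)); last by nia.
rewrite [RHS]big_mkcond; apply: eq_bigr => j _.
rewrite fps_exp1 -[(_ + k + _)%N]addnA IHn; case: ltnP => // ltnj.
by rewrite riordan_gt ?mulr0 //; lia.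
Qed.
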